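(* Let $K$ be an $\mathcal R$-dioid. For every $\phi\in K\otimes_{\mathcal R}C_2'$ there are $n\ge 1$, $S\in\{0,1\}^{1\times n}$, $F\in\{0,1\}^{n\times 1}$, $U\in\{0,p_0,p_1\}^{n\times n}$, $V\in\{0,q_0,q_1\}^{n\times n}$ and $N\in(Z_{C_2'}K)^{n\times n}$ such that \[ \phi=S(NV)^*N(UN)^*F. \] Moreover, $N$ is the least solution of $y\ge (UyV+N)^*$ in $\mathrm{Mat}_{n\times n}(Z_{C_2'}K)$.
   Context: An $\mathcal R$-dioid is a dioid in which every regular subset $A$ of its multiplicative monoid has a least upper bound $\sum A$ with $\sum(AB)=(\sum A)(\sum B)$; equivalently, a $*$-continuous Kleene algebra. An $\mathcal R$-morphism is a dioid morphism preserving suprema of regular sets; an $\mathcal R$-congruence is a semiring congruence $\rho$ such that regular sets with equal downward closures modulo $\rho$ have congruent suprema. $C_2'=\mathcal R\Delta_2^*/\rho$ with $\Delta_2=\{p_0,p_1,q_0,q_1\}$, $\mathcal R\Delta_2^*$ the algebra of regular languages over $\Delta_2$, and $\rho$ the least $\mathcal R$-congruence containing $p_iq_j=\delta_{i,j}$ ($i,j<2$). $K\otimes_{\mathcal R}C_2'$ is the tensor product of $\mathcal R$-dioids (universal $\mathcal R$-dioid receiving $\mathcal R$-morphisms from $K$ and $C_2'$ with elementwise commuting images); elements of $K,C_2'$ are identified with their images. $Z_{C_2'}K$ is the set of elements of $K\otimes_{\mathcal R}C_2'$ commuting with all elements of $C_2'$; it is closed under the Kleene algebra operations. Matrices carry the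 standard matrix Kleene algebra structure; scalars multiplied with matrices are identified with diagonal matrices. *)

(* Defs.v *)
From HB Require Import structures.
From mathcomp Require Import all_boot all_algebra.
From Stdlib Require Import ClassicalEpsilon.
Set Implicit Arguments. Unset Strict Implicit. Unset Printing Implicit Defensive.
Import GRing.Theory.
Local Open Scope ring_scope.

Section Dioid.
Variable D : pzSemiRingType.

Definition dle (a b : D) : Prop := a + b = b.

Definition is_ub (A : D -> Prop) (u : D) : Prop := forall a, A a -> dle a u.
Definition is_lub (A : D -> Prop) (s : D) : Prop :=
  is_ub A s /\ forall u, is_ub A u -> dle s u.

Definition setmul (A B : D -> Prop) : D -> Prop :=
  fun x => exists a b, A a /\ B b /\ x = a * b.
Definition setstar (A : D -> Prop) : D -> Prop :=
  fun x => exists s : seq D, (forall a, a \in s -> A a) /\ x = \prod_(a <- s) a.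

Inductive regular : (D -> Prop) -> Prop :=
| reg_empty : regular (fun _ => False)
| reg_single a : regular (fun x => x = a)
| reg_union A B : regular A -> regular B -> regular (fun x => A x \/ B x)
| reg_mul A B : regular A -> regular B -> regular (setmul A B)
| reg_star A : regular A -> regular (setstar A)
| reg_ext A B : regular A -> (forall x, A x <-> B x) -> regular B.

Definition Rdioid : Prop :=
  (forall a : D, a + a = a) /\
  (forall A, regular A -> exists s, is_lub A s) /\
  (forall A B a b, regular A -> regular B -> is_lub A a -> is_lub B b ->
     is_lub (setmul A B) (a * b)).

(* supremum (meaningful for regular sets in an R-dioid) *)
Definition rsup (A : D -> Prop) : D := epsilon (inhabits 0) (is_lub A).

Definition kstar (a : D) : D := rsup (setstar (fun x => x = a)).

(* standard Kleene star on square matrices (Conway's block formula) *)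
Fixpoint mxstar (n : nat) : 'M[D]_n -> 'M[D]_n :=
  match n return 'M[D]_n -> 'M[D]_n with
  | 0 => fun A => A
  | m.+1 => fun A =>
      let A' : 'M[D]_(1 + m) := A in
      let a := ulsubmx A' in
      let b := ursubmx A' in
      let c := dlsubmx A' in
      let d := drsubmx A' in
      let as_ : 'M[D]_1 := (kstar (a ord0 ord0))%:M in
      let f := mxstar (d + c *m as_ *m b) in
      (block_mx (as_ + as_ *m b *m f *m c *m as_) (as_ *m b *m f)
                (f *m c *m as_) f : 'M[D]_(1 + m))
  end.

Definition mxle (m n : nat) (A B : 'M[D]_(m, n)) : Prop := A + B = B.

End Dioid.

Definition Rmorph (D E : pzSemiRingType) (f : D -> E) : Prop :=
  f 0 = 0 /\ f 1 = 1 /\ (forall a b, f (a + b) = f a + f b) /\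
  (forall a b, f (a * b) = f a * f b) /\
  (forall A s, regular A -> is_lub A s ->
     is_lub (fun y => exists x, A x /\ y = f x) (f s)).

(* C is (a copy of) C_2' = R Delta_2^* / rho, i.e. the R-dioid presented by
   generators p0 p1 q0 q1 and relations p_i q_j = delta_ij *)
Definition is_C2 (C : pzSemiRingType) (p0 p1 q0 q1 : C) : Prop :=
  Rdioid C /\
  p0 * q0 = 1 /\ p0 * q1 = 0 /\ p1 * q0 = 0 /\ p1 * q1 = 1 /\
  forall (E : pzSemiRingType) (e0 e1 f0 f1 : E), Rdioid E ->
    e0 * f0 = 1 -> e0 * f1 = 0 -> e1 * f0 = 0 -> e1 * f1 = 1 ->
    exists h : C -> E, (Rmorph h /\ h p0 = e0 /\ h p1 = e1 /\ h q0 = f0 /\ h q1 = f1) /\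
      forall h' : C -> E, Rmorph h' -> h' p0 = e0 -> h' p1 = e1 -> h' q0 = f0 ->
        h' q1 = f1 -> forall x, h' x = h x.

Definition is_Rtensor (K C T : pzSemiRingType) (iK : K -> T) (iC : C -> T) : Prop :=
  Rdioid T /\ Rmorph iK /\ Rmorph iC /\
  (forall k c, iK k * iC c = iC c * iK k) /\
  forall (E : pzSemiRingType) (f : K -> E) (g : C -> E), Rdioid E ->
    Rmorph f -> Rmorph g -> (forall k c, f k * g c = g c * f k) ->
    exists h : T -> E, (Rmorph h /\ (forall k, h (iK k) = f k) /\ (forall c, h (iC c) = g c)) /\
      forall h' : T -> E, Rmorph h' -> (forall k, h' (iK k) = f k) ->
        (forall c, h' (iC c) = g c) -> forall x, h' x = h x.

Definition inZ (C T : pzSemiRingType) (iC : C -> T) (x : T) : Prop :=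
  forall c, x * iC c = iC c * x.

(* Main.v *)
(** In [C2'], the words [p0 w q0], where [w] is built from central elements, the
    opening brackets [p0 p1], [p1 p1] and the closing brackets [q1 q0], [q1 q1],
    vanish unless the brackets of [w] match, and then equal the product of the
    central letters. Hence for an automaton [A = U + X + V] with central [X], the
    starred matrix of the automaton re-encoded with these brackets, flanked by
    [p0] and [q0], is a central matrix [N] collecting exactly the balanced runs of
    [A], and [A^* = (NV)^* N (UN)^*] is Kleene algebra. That every element of the
    tensor product is [S A^* F] follows by closure under the Kleene algebra
    operations, since by the universal properties neither the tensor product nor
    [C2'] has a proper sub-R-dioid containing its generators. *)

Require Import Defs.
From HB Require Import structures.
From mathcomp Require Import all_boot all_algebra.
From Stdlib Require Import ClassicalEpsilon.
Set Implicit Arguments. Unset Strict Implicit. Unset Printing Implicit Defensive.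
Import GRing.Theory.
Local Open Scope ring_scope.

(** * Star-continuity and Kleene algebra of matrices *)

Section RdioidTheory.
Variable D : pzSemiRingType.
Hypothesis HD : Rdioid D.

Lemma dioid_addxx (a : D) : a + a = a. Proof. by case: HD. Qed.

Lemma dle_refl (a : D) : dle a a. Proof. exact: dioid_addxx. Qed.

Lemma dle_eq (a b : D) : a = b -> dle a b. Proof. by move=> ->; apply: dle_refl. Qed.

Lemma dle_trans (b a c : D) : dle a b -> dle b c -> dle a c.
Proof. by rewrite /dle => ab <-; rewrite addrA ab. Qed.

Lemma dle_anti (a b : D) : dle a b -> dle b a -> a = b.
Proof. by rewrite /dle => ab ba; rewrite -ba addrC. Qed.

Lemma dle0x (a : D) : dle 0 a. Proof. by rewrite /dle add0r. Qed.

Lemma dle_addl (a b : D) : dle a (a + b).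
Proof. by rewrite /dle addrA dioid_addxx. Qed.

Lemma dle_addr (a b : D) : dle b (a + b).
Proof. by rewrite addrC; apply: dle_addl. Qed.

Lemma dle_join (a b c : D) : dle a c -> dle b c -> dle (a + b) c.
Proof. by rewrite /dle => ac bc; rewrite -addrA bc. Qed.

Lemma dle_mul2l (c a b : D) : dle a b -> dle (c * a) (c * b).
Proof. by rewrite /dle -mulrDr => ->. Qed.

Lemma dle_mul2r (c a b : D) : dle a b -> dle (a * c) (b * c).
Proof. by rewrite /dle -mulrDl => ->. Qed.

Lemma dle_mul (a b c d : D) : dle a b -> dle c d -> dle (a * c) (b * d).
Proof. by move=> ab cd; apply: (@dle_trans (b * c)); [apply: dle_mul2r|apply: dle_mul2l]. Qed.

Lemma dle_sum (I : finType) (F : I -> D) (c : D) :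
  (forall i, dle (F i) c) -> dle (\sum_i F i) c.
Proof. by move=> h; elim/big_ind: _ => //; [exact: dle0x|move=> x y; exact: dle_join]. Qed.

Lemma dle_sum_term (I : finType) (F : I -> D) i : dle (F i) (\sum_j F j).
Proof. by rewrite (bigD1 i) //=; apply: dle_addl. Qed.

Lemma is_lub_uniq (A : D -> Prop) (s t : D) : is_lub A s -> is_lub A t -> s = t.
Proof. by move=> [s1 s2] [t1 t2]; apply: dle_anti; [apply: s2|apply: t2]. Qed.

Lemma is_lub_ext (A B : D -> Prop) (s : D) :
  (forall x, A x <-> B x) -> is_lub A s -> is_lub B s.
Proof.
move=> AB [ub lub]; split=> [a /AB|u hu]; first exact: ub.
by apply: lub => a /AB; apply: hu.
Qed.

Lemma is_lub_single (a : D) : is_lub (fun x => x = a) a.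
Proof. by split=> [_ ->|u]; [exact: dle_refl|apply]. Qed.

Lemma is_lub_union (A B : D -> Prop) (a b : D) :
  is_lub A a -> is_lub B b -> is_lub (fun x => A x \/ B x) (a + b).
Proof.
move=> [ubA lubA] [ubB lubB]; split=> [x [/ubA xa|/ubB xb]|u hu].
- exact: dle_trans xa (dle_addl _ _).
- exact: dle_trans xb (dle_addr _ _).
- by apply: dle_join; [apply: lubA|apply: lubB] => x hx; apply: hu; [left|right].
Qed.

Lemma is_lub_mul (A B : D -> Prop) (a b : D) : regular A -> regular B ->
  is_lub A a -> is_lub B b -> is_lub (setmul A B) (a * b).
Proof. by case: HD => _ [_ h]; apply: h. Qed.

Lemma setstar_exp (a : D) k : setstar (fun x => x = a) (a ^+ k).
Proof.
exists (nseq k a); split=> [x|]; first by rewrite mem_nseq => /andP[_ /eqP].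
by rewrite big_nseq -Monoid.iteropE.
Qed.

Lemma setstar_single (a x : D) : setstar (fun x => x = a) x -> exists k, x = a ^+ k.
Proof.
move=> [s [hs ->]]; exists (size s); elim: s hs => [|y s IH] hs; first by rewrite big_nil.
rewrite big_cons IH => [|z zs]; last by apply: hs; rewrite inE zs orbT.
by rewrite (hs y) ?mem_head // exprS.
Qed.

Lemma is_lub_kstar (a : D) : is_lub (setstar (fun x => x = a)) (kstar a).
Proof.
apply: epsilon_spec; case: HD => _ [h _]; apply: h.
exact/reg_star/reg_single.
Qed.

(** Star-continuity in a two-sided context: multiplicativity of suprema, applied twice to regular
    sets, makes [x * kstar a * y] the supremum of the [x * a ^+ k * y]. *)
Lemma kstar_ind (a x y z : D) :
  (forall k, dle (x * a ^+ k * y) z) -> dle (x * kstar a * y) z.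
Proof.
move=> h; have rs := reg_star (reg_single a).
have rx := reg_single x; have ry := reg_single y.
have := is_lub_mul (reg_mul rx rs) ry
  (is_lub_mul rx rs (is_lub_single x) (is_lub_kstar a)) (is_lub_single y).
case=> _; apply=> _ [_ [_ [[_ [w [-> [/setstar_single[k ->] ->]]]] [-> ->]]]].
exact: h.
Qed.

Lemma kstar_unfold (a : D) : 1 + a * kstar a = kstar a.
Proof.
have [ub lub] := is_lub_kstar a.
have le_exp k : dle (a ^+ k) (kstar a) by apply/ub/setstar_exp.
apply: dle_anti.
  apply: dle_join; first exact: (le_exp 0%N).
  rewrite -[X in dle X _]mulr1; apply: kstar_ind => k.
  by rewrite mulr1 -exprS.
apply: lub => _ /setstar_single[[|k] ->]; first by rewrite expr0; apply: dle_addl.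
by rewrite exprS; apply: dle_trans (dle_addr _ _); apply: dle_mul2l.
Qed.

Lemma is_lub_star (A : D -> Prop) (a : D) : regular A -> is_lub A a ->
  is_lub (setstar A) (kstar a).
Proof.
move=> rA lA; have le1 : dle 1 (kstar a).
  by rewrite -kstar_unfold; apply: dle_addl.
split=> [_ [s [hs ->]]|u hu].
  elim: s hs => [|x s IH] hs; first by rewrite big_nil.
  rewrite big_cons -kstar_unfold; apply: dle_trans (dle_addr _ _).
  apply: dle_mul; first by case: lA => + _; apply; apply: hs; rewrite mem_head.
  by apply: IH => z zs; apply: hs; rewrite inE zs orbT.
case: HD => _ [/(_ _ (reg_star rA))[s ls] _].
(* Prepending an element of [A] stays in [setstar A], so its supremum [s] absorbs [a] on the left
   and lies above every power of [a]. *)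
suff le_s k : dle (a ^+ k) s.
  rewrite -[kstar a]mul1r -[X in dle X _]mulr1; apply: kstar_ind => k.
  by rewrite mul1r mulr1; apply: dle_trans (le_s k) _; case: ls => _; apply.
elim: k => [|k IH].
  by case: ls => + _; apply; exists [::]; rewrite big_nil.
rewrite exprS; apply: (@dle_trans (a * s)); first exact: dle_mul2l.
have [_] := is_lub_mul rA (reg_star rA) lA ls; apply=> _ [x [_ [Ax [[l [hl ->]] ->]]]].
case: ls => + _; apply; exists (x :: l); rewrite big_cons; split=> // z.
by rewrite inE => /orP[/eqP->|/hl].
Qed.

(* [t] behaves as a supremum of elements below it that lie in [W], in every
   multiplicative context; [t] itself need not be an upper bound of [W]. *)
Definition approx (t : D) (W : D -> Prop) : Prop :=
  forall x y z, (forall w, W w -> dle (x * w * y) z) -> dle (x * t * y) z.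

Lemma approx_mem (t : D) (W : D -> Prop) : W t -> approx t W.
Proof. by move=> Wt x y z; apply. Qed.

Lemma approx0 (W : D -> Prop) : approx 0 W.
Proof. by move=> x y z _; rewrite mulr0 mul0r; apply: dle0x. Qed.

Lemma approxD (a b : D) (W : D -> Prop) : approx a W -> approx b W -> approx (a + b) W.
Proof.
move=> ha hb x y z h; rewrite mulrDr mulrDl.
by apply: dle_join; [apply: ha|apply: hb].
Qed.

Lemma approx_mul (a b : D) (A B W : D -> Prop) : approx a A -> approx b B ->
  (forall u v, A u -> B v -> W (u * v)) -> approx (a * b) W.
Proof.
move=> ha hb AB x y z h; rewrite mulrA -mulrA; apply: ha => u Au.
rewrite mulrA; apply: hb => v Bv; rewrite -(mulrA x); exact/h/AB.
Qed.

Lemma approx_kstar (a : D) (W : D -> Prop) : approx a W -> W 1 ->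
  (forall u v, W u -> W v -> W (u * v)) -> approx (kstar a) W.
Proof.
move=> ha W1 WM x y z h; apply: kstar_ind => k.
suff: approx (a ^+ k) W by apply.
elim: k => [|k IH]; first exact: approx_mem.
by rewrite exprS; apply: approx_mul WM.
Qed.

(** * Approximation of matrices and of their stars *)

Definition mxapprox m n (A : 'M[D]_(m, n)) (W : 'I_m -> 'I_n -> D -> Prop) :=
  forall i j, approx (A i j) (W i j).

Lemma mxapproxD m n (A B : 'M[D]_(m, n)) W :
  mxapprox A W -> mxapprox B W -> mxapprox (A + B) W.
Proof. by move=> hA hB i j; rewrite mxE; apply: approxD. Qed.

Lemma mxapprox_mul m n p (A : 'M[D]_(m, n)) (B : 'M[D]_(n, p)) WA WB W :
  mxapprox A WA -> mxapprox B WB ->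
  (forall i j k u v, WA i j u -> WB j k v -> W i k (u * v)) ->
  mxapprox (A *m B) W.
Proof.
move=> hA hB hW i k; rewrite mxE; elim/big_ind: _ => [|x y|j _].
- exact: approx0.
- exact: approxD.
- apply: approx_mul (hA i j) (hB j k) _; exact: hW.
Qed.

Lemma mxstarS m (A : 'M[D]_(1 + m)) :
  let a := ulsubmx A in let b := ursubmx A in
  let c := dlsubmx A in let d := drsubmx A in
  let as_ : 'M[D]_1 := (kstar (a ord0 ord0))%:M in
  let f := mxstar (d + c *m as_ *m b) in
  @mxstar D m.+1 A = block_mx (as_ + as_ *m b *m f *m c *m as_) (as_ *m b *m f)
                (f *m c *m as_) f.
Proof. by []. Qed.

(** [W] is typed by endpoints, like the labels of paths from [i] to [j]. Conway's formula only
    multiplies entries with matching endpoints, so closure under identities and composition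
    suffices. Claims about stars can then be checked word by word. *)
Lemma mxstar_approx n (A : 'M[D]_n) (W : 'I_n -> 'I_n -> D -> Prop) :
  (forall i, W i i 1) ->
  (forall i j k u v, W i j u -> W j k v -> W i k (u * v)) ->
  mxapprox A W -> mxapprox (mxstar A) W.
Proof.
elim: n A W => [|m IH] A W W1 WM hA; first by case.
rewrite -[A]/(A : 'M_(1 + m)) in hA *; rewrite mxstarS.
set a := ulsubmx _; set b := ursubmx _; set c := dlsubmx _; set d := drsubmx _.
set as_ := (kstar _)%:M; set f := mxstar _.
pose l (i : 'I_1) : 'I_(1 + m) := lshift m i.
pose r (i : 'I_m) : 'I_(1 + m) := rshift 1 i.
pose Wll i j := W (l i) (l j); pose Wlr i j := W (l i) (r j).
pose Wrl i j := W (r i) (l j); pose Wrr i j := W (r i) (r j).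
have ha : mxapprox a Wll by move=> i j; rewrite !mxE; apply: hA.
have hb : mxapprox b Wlr by move=> i j; rewrite !mxE; apply: hA.
have hc : mxapprox c Wrl by move=> i j; rewrite !mxE; apply: hA.
have hd : mxapprox d Wrr by move=> i j; rewrite !mxE; apply: hA.
have has : mxapprox as_ Wll.
  move=> i j; rewrite mxE !ord1 eqxx mulr1n.
  by apply: approx_kstar; [exact: ha|exact: W1|move=> u v; exact: WM].
(* The maps [s1], [s2], [s3] embed block indices into the full index type, so that one statement
   covers all block products. *)
have mulM p1 p2 p3 (s1 : 'I_p1 -> 'I_m.+1) (s2 : 'I_p2 -> 'I_m.+1) (s3 : 'I_p3 -> 'I_m.+1) B C :
    mxapprox B (fun i j => W (s1 i) (s2 j)) -> mxapprox C (fun i j => W (s2 i) (s3 j)) ->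
    mxapprox (B *m C) (fun i j => W (s1 i) (s3 j)).
  by move=> hB hC; apply: mxapprox_mul hB hC _ => i j k u v; apply: WM.
have hf : mxapprox f Wrr.
  apply: IH => [i|i j k u v|]; [exact: W1|exact: WM|].
  apply: mxapproxD => //; apply: (mulM _ _ _ r l r) => //.
  exact: (mulM _ _ _ r l l).
have hasbf : mxapprox (as_ *m b *m f) Wlr.
  by apply: (mulM _ _ _ l r r) => //; apply: (mulM _ _ _ l l r).
have hfcas : mxapprox (f *m c *m as_) Wrl.
  by apply: (mulM _ _ _ r l l) => //; apply: (mulM _ _ _ r r l).
move=> i j; case: (@split_ordP 1 m i) => i' ->; case: (@split_ordP 1 m j) => j' ->.
- rewrite (@block_mxEul D 1 m 1 m); apply: (mxapproxD has).
  by apply: (mulM _ _ _ l l l) => //; apply: (mulM _ _ _ l r l).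
- by rewrite (@block_mxEur D 1 m 1 m); apply: hasbf.
- by rewrite (@block_mxEdl D 1 m 1 m); apply: hfcas.
- by rewrite (@block_mxEdr D 1 m 1 m); apply: hf.
Qed.

Lemma mxstar_unfold n (A : 'M[D]_n) : 1%:M + A *m mxstar A = mxstar A.
Proof.
elim: n A => [|m IH] A; first by apply/matrixP => -[].
rewrite mxstarS.
set a := ulsubmx _; set b := ursubmx _; set c := dlsubmx _; set d := drsubmx _.
set as_ := (kstar _)%:M; set f := mxstar _.
have has : 1%:M + a *m as_ = as_.
  apply/matrixP => i j; rewrite !ord1 mxE [X in _ + X]mxE big_ord1 [as_ _ _]mxE mxE.
  exact: kstar_unfold.
have hf : 1%:M + (d + c *m as_ *m b) *m f = f by apply: IH.
rewrite -[A in LHS](@submxK D 1 m 1 m) -/a -/b -/c -/d.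
rewrite (@mulmx_block D 1 m 1 m 1 m) [1%:M](@scalar_mx_block D 1 m).
(* Each block is settled by the unfolding equation [has] or [hf]. *)
rewrite (@add_block_mx D 1 m 1 m); apply: (f_equal4 (@block_mx D 1 m 1 m)).
- rewrite mulmxDr !addrA has -addrA; congr (_ + _).
  by rewrite -[X in _ = X *m _ *m _ *m _ *m _]has !mulmxDl !mul1mx !mulmxA addrC.
- by rewrite add0r -[X in _ = X *m _ *m _]has !mulmxDl !mul1mx !mulmxA addrC.
- by rewrite add0r -[X in _ = X *m _ *m _]hf !mulmxDl !mul1mx mulmxDr !mulmxA addrA addrAC.
- by rewrite addrA -[RHS]hf mulmxDl !mulmxA addrAC -addrA addrA.
Qed.

(** * The entrywise order and the Kleene algebra of matrices *)

Lemma mxleP m n (A B : 'M[D]_(m, n)) : mxle A B <-> forall i j, dle (A i j) (B i j).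
Proof.
split=> [AB i j|AB]; first by move/matrixP/(_ i j): AB; rewrite mxE.
by apply/matrixP => i j; rewrite mxE; apply: AB.
Qed.

Lemma mxle_refl m n (A : 'M[D]_(m, n)) : mxle A A.
Proof. by apply/mxleP => i j; apply: dle_refl. Qed.

Lemma mxle_trans m n (B A C : 'M[D]_(m, n)) : mxle A B -> mxle B C -> mxle A C.
Proof. by move=> AB BC; rewrite /mxle -BC addrA AB. Qed.

Lemma mxle_anti m n (A B : 'M[D]_(m, n)) : mxle A B -> mxle B A -> A = B.
Proof. by rewrite /mxle => AB BA; rewrite -BA addrC. Qed.

Lemma mxle_addl m n (A B : 'M[D]_(m, n)) : mxle A (A + B).
Proof. by apply/mxleP => i j; rewrite mxE; apply: dle_addl. Qed.

Lemma mxle_addr m n (A B : 'M[D]_(m, n)) : mxle B (A + B).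
Proof. by rewrite addrC; apply: mxle_addl. Qed.

Lemma mxle_join m n (A B C : 'M[D]_(m, n)) : mxle A C -> mxle B C -> mxle (A + B) C.
Proof. by rewrite /mxle => AC BC; rewrite -addrA BC. Qed.

Lemma mxle_mul2l m n p (C : 'M[D]_(m, n)) (A B : 'M[D]_(n, p)) :
  mxle A B -> mxle (C *m A) (C *m B).
Proof. by rewrite /mxle -mulmxDr => ->. Qed.

Lemma mxle_mul2r m n p (C : 'M[D]_(n, p)) (A B : 'M[D]_(m, n)) :
  mxle A B -> mxle (A *m C) (B *m C).
Proof. by rewrite /mxle -mulmxDl => ->. Qed.

Lemma mxle_mul m n p (A B : 'M[D]_(m, n)) (A' B' : 'M[D]_(n, p)) :
  mxle A B -> mxle A' B' -> mxle (A *m A') (B *m B').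
Proof.
move=> AB AB'; apply: (@mxle_trans _ _ (B *m A')); first exact: mxle_mul2r.
exact: mxle_mul2l.
Qed.

Lemma mxle_mul_term m n p (A : 'M[D]_(m, n)) (B : 'M[D]_(n, p)) i j k :
  dle (A i j * B j k) ((A *m B) i k).
Proof. by rewrite mxE; apply: (dle_sum_term (fun j => A i j * B j k)). Qed.

Lemma mxle_mulP m n p (A : 'M[D]_(m, n)) (B : 'M[D]_(n, p)) (C : 'M[D]_(m, p)) :
  (forall i j k, dle (A i j * B j k) (C i k)) <-> mxle (A *m B) C.
Proof.
split=> [h|/mxleP h i j k]; last exact: dle_trans (mxle_mul_term _ _ _ _ _) (h i k).
by apply/mxleP => i k; rewrite mxE; apply: dle_sum.
Qed.

Lemma mxstar_ge1 n (A : 'M[D]_n) : mxle 1%:M (mxstar A).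
Proof. by rewrite -mxstar_unfold; apply: mxle_addl. Qed.

Lemma mxstar_mull n (A : 'M[D]_n) : mxle (A *m mxstar A) (mxstar A).
Proof. by rewrite -[X in mxle _ X]mxstar_unfold; apply: mxle_addr. Qed.

(** The sets [W i j] of elements carrying row [j] of [Y] below row [i] contain [1] on the diagonal
    and compose, so the property passes from the entries of [A] to those of its star. *)
Lemma mxstar_indl n p (A : 'M[D]_n) (Y : 'M[D]_(n, p)) :
  mxle (A *m Y) Y -> mxle (mxstar A *m Y) Y.
Proof.
move=> /mxle_mulP AY; apply/mxle_mulP => i j k.
pose W i j w := forall k, dle (w * Y j k) (Y i k).
have hA : mxapprox A W by move=> i' j'; apply: approx_mem => k'.
have W1 i' : W i' i' 1 by move=> k'; rewrite mul1r; apply: dle_refl.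
have WM i' j' l u v : W i' j' u -> W j' l v -> W i' l (u * v).
  move=> hu hv k'; rewrite -mulrA; exact: dle_trans (dle_mul2l _ (hv k')) (hu k').
rewrite -(mul1r (mxstar A i j)); apply: (mxstar_approx W1 WM hA) => w Ww.
by rewrite mul1r.
Qed.

Lemma mxstar_mulxx n (A : 'M[D]_n) : mxle (mxstar A *m mxstar A) (mxstar A).
Proof. exact/mxstar_indl/mxstar_mull. Qed.

Lemma mxstar_ge n (A : 'M[D]_n) : mxle A (mxstar A).
Proof.
apply: mxle_trans (mxstar_mull A); rewrite -{1}[A]mulmx1.
exact/mxle_mul2l/mxstar_ge1.
Qed.

(** Stars of compound matrices are computed below by exhibiting the least solution of a linear
    inequality. *)
Lemma mxstar_lfp n p (A : 'M[D]_n) (B Y : 'M[D]_(n, p)) :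
  mxle (A *m Y + B) Y -> (forall Z, mxle (A *m Z + B) Z -> mxle Y Z) ->
  mxstar A *m B = Y.
Proof.
move=> hY lY; apply: mxle_anti.
  apply: (@mxle_trans _ _ (mxstar A *m Y)).
    exact/mxle_mul2l/(mxle_trans _ hY)/mxle_addr.
  exact/mxstar_indl/(mxle_trans _ hY)/mxle_addl.
apply: lY; rewrite -{2}mxstar_unfold mulmxDl mul1mx mulmxA addrC; exact: mxle_refl.
Qed.

Lemma mxstar_lfp_le n p (A : 'M[D]_n) (B Z : 'M[D]_(n, p)) :
  mxle (A *m Z + B) Z -> mxle (mxstar A *m B) Z.
Proof.
move=> hZ; apply: (@mxle_trans _ _ (mxstar A *m Z)).
  exact/mxle_mul2l/(mxle_trans _ hZ)/mxle_addr.
exact/mxstar_indl/(mxle_trans _ hZ)/mxle_addl.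
Qed.

(** Back substitution: the lower component solves its own inequality, and the solution enters the
    constant term of the upper one. *)
Lemma mxstar_block_upper m n p (A : 'M[D]_m) (G : 'M[D]_(m, n)) (B : 'M[D]_n)
    (E : 'M[D]_(m, p)) (F : 'M[D]_(n, p)) :
  mxstar (block_mx A G 0 B) *m col_mx E F =
  col_mx (mxstar A *m (G *m (mxstar B *m F) + E)) (mxstar B *m F).
Proof.
have unf k (M : 'M[D]_k) (X : 'M[D]_(k, p)) :
    M *m (mxstar M *m X) + X = mxstar M *m X.
  by rewrite -[in RHS]mxstar_unfold mulmxDl mul1mx mulmxA addrC.
apply: mxstar_lfp => [|Z].
  rewrite mul_block_col mul0mx add0r add_col_mx unf -addrA unf; exact: mxle_refl.
rewrite -[Z]vsubmxK; move: (usubmx Z) (dsubmx Z) => Z1 Z2 {Z}.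
rewrite mul_block_col mul0mx add0r add_col_mx => /mxleP hZ.
have h2 : mxle (mxstar B *m F) Z2.
  by apply/mxstar_lfp_le/mxleP => i j; have := hZ (rshift m i) j; rewrite !col_mxEd.
have h1 : mxle (A *m Z1 + (G *m Z2 + E)) Z1.
  by apply/mxleP => i j; have := hZ (lshift n i) j; rewrite !col_mxEu addrA.
rewrite /mxle add_col_mx h2; congr col_mx.
apply: (mxle_trans _ (mxstar_lfp_le h1)); apply: mxle_mul2l.
apply: mxle_join; last exact: mxle_addr.
exact: mxle_trans (mxle_mul2l _ h2) (mxle_addl _ _).
Qed.

Lemma mxstar_least n (A Y : 'M[D]_n) : mxle 1%:M Y -> mxle (A *m Y) Y -> mxle (mxstar A) Y.
Proof.
move=> Y1 AY; rewrite -[mxstar A]mulmx1.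
exact: mxle_trans (mxle_mul2l _ Y1) (mxstar_indl AY).
Qed.

Lemma mxstar_le n (A B : 'M[D]_n) : mxle A (mxstar B) -> mxle (mxstar A) (mxstar B).
Proof.
move=> AB; apply: mxstar_least; first exact: mxstar_ge1.
exact: mxle_trans (mxle_mul2r _ AB) (mxstar_mulxx B).
Qed.

(** Cutting a run at each feedback edge [F *m S] leaves a first piece [mxstar A *m F] followed by
    loops [S *m mxstar A *m F]. *)
Lemma mxstar_feedback n (A : 'M[D]_n) (S : 'rV[D]_n) (F : 'cV[D]_n) :
  mxstar (A + F *m S) *m F = mxstar A *m F *m mxstar (S *m mxstar A *m F).
Proof.
set f := S *m mxstar A *m F; apply: mxstar_lfp => [|Z hZ].
  suff -> : (A + F *m S) *m (mxstar A *m F *m mxstar f) + F =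
      mxstar A *m F *m mxstar f by apply: mxle_refl.
  have -> : (A + F *m S) *m (mxstar A *m F *m mxstar f) + F =
      A *m mxstar A *m F *m mxstar f + F *m (1%:M + f *m mxstar f).
    by rewrite mulmxDl mulmxDr mulmx1 /f !mulmxA -addrA [F + _]addrC.
  rewrite mxstar_unfold -!mulmxDl -[X in _ + X]mul1mx -mulmxDl.
  by rewrite [_ + 1%:M]addrC mxstar_unfold.
have hZ1 : mxle (mxstar A *m (F *m (1%:M + S *m Z))) Z.
  apply: mxstar_lfp_le; apply: mxle_trans hZ.
  rewrite mulmxDr mulmx1 mulmxDl -mulmxA addrAC addrA; exact: mxle_refl.
apply: (mxle_trans _ hZ1); rewrite mulmxA; apply: mxle_mul2l.
apply: mxstar_least; first exact: mxle_addl.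
apply: mxle_trans (mxle_addr _ _).
have := mxle_mul2l S hZ1; rewrite !mulmxA; exact.
Qed.

Lemma mxstar11 (A : 'M[D]_1) : mxstar A ord0 ord0 = kstar (A ord0 ord0).
Proof.
have -> : ord0 = lshift 0 ord0 :> 'I_(1 + 0) by apply: val_inj.
rewrite (@mxstarS 0 A) (@block_mxEul D 1 0 1 0).
set b := ursubmx _; rewrite (thinmx0 b) !(mulmx0, mul0mx) addr0 mxE eqxx mulr1n mxE.
by rewrite mxE; congr (kstar (A _ _)); apply: val_inj.
Qed.

(** In a run, unmatched closing brackets precede unmatched opening ones, and [N] collects the
    balanced pieces between them. Algebraically, [G *m N *m H] lies above [1] and absorbs [U], [X]
    and [V] on the left. *)
Lemma mxstar_normal_form n (U X V N : 'M[D]_n) :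
  mxle 1%:M N -> mxle (N *m N) N -> mxle X N -> mxle (U *m N *m V) N ->
  mxle N (mxstar (U + X + V)) ->
  mxstar (U + X + V) = mxstar (N *m V) *m N *m mxstar (U *m N).
Proof.
set A := U + X + V => N1 NN XN UNV NA.
set G := mxstar (N *m V); set H := mxstar (U *m N).
have UA : mxle U (mxstar A).
  by apply: mxle_trans (mxstar_ge A); rewrite /A -addrA; apply: mxle_addl.
have VA : mxle V (mxstar A).
  by apply: mxle_trans (mxstar_ge A); apply: mxle_addr.
have AM (M M' : 'M[D]_n) : mxle M (mxstar A) -> mxle M' (mxstar A) ->
    mxle (M *m M') (mxstar A).
  by move=> MA MA'; apply: mxle_trans (mxle_mul MA MA') (mxstar_mulxx A).
have leM1 p (M : 'M[D]_(n, p)) : mxle M (N *m M).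
  by rewrite -{1}[M]mul1mx; apply: mxle_mul2r.
have G1 p (M : 'M[D]_(n, p)) : mxle M (G *m M).
  by rewrite -{1}[M]mul1mx; apply/mxle_mul2r/mxstar_ge1.
have GNE : G *m N = N + N *m V *m G *m N.
  by rewrite -{1}[G]mxstar_unfold mulmxDl mul1mx.
have NGN : mxle (N *m (G *m N)) (G *m N).
  rewrite {1}GNE mulmxDr GNE; apply: mxle_join; first exact: mxle_trans NN (mxle_addl _ _).
  by apply: mxle_trans (mxle_addr _ _); rewrite !mulmxA; do 3!apply: mxle_mul2r.
have NGNH : mxle (N *m (G *m N *m H)) (G *m N *m H).
  by rewrite mulmxA; apply: mxle_mul2r.
apply: mxle_anti; last first.
  by apply: (AM _ _ (AM _ _ _ NA) _); apply: mxstar_le; apply: AM.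
apply: mxstar_least.
  apply: (mxle_trans (mxstar_ge1 (U *m N))); rewrite -mulmxA.
  exact: mxle_trans (leM1 _ _) (G1 _ _).
rewrite /A !mulmxDl; apply: mxle_join; first apply: mxle_join.
(* By [GNE], either [N] comes next and [H] absorbs [U *m N], or [N *m V] comes next and
   [U *m N *m V] is below [N], which [NGNH] absorbs. *)
- rewrite {1}GNE mulmxDl mulmxDr; apply: mxle_join.
    rewrite mulmxA; apply: (mxle_trans (mxstar_mull (U *m N))); rewrite -mulmxA.
    exact: mxle_trans (leM1 _ _) (G1 _ _).
  apply: mxle_trans NGNH; rewrite !mulmxA; do 3!apply: mxle_mul2r.
  by [].
- exact: mxle_trans (mxle_mul2r _ XN) NGNH.
- apply: (mxle_trans (leM1 _ _)); rewrite !mulmxA; do 2!apply: mxle_mul2r.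
  exact: mxstar_mull.
Qed.

End RdioidTheory.

(** * Sub-R-dioids and the universal properties *)

Definition img (D E : Type) (f : D -> E) (A : D -> Prop) : E -> Prop :=
  fun y => exists x, A x /\ y = f x.

Section Images.
Variables (D E : pzSemiRingType) (f : D -> E).
Hypotheses (f1 : f 1 = 1) (fM : forall a b, f (a * b) = f a * f b).

Lemma img_setmul A B y : img f (setmul A B) y <-> setmul (img f A) (img f B) y.
Proof.
split=> [[_ [[a [b [Aa [Bb ->]]]] ->]]|[_ [_ [[a [Aa ->]] [[b [Bb ->]] ->]]]]].
  by exists (f a), (f b); split; [exists a|split; [exists b|]].
by exists (a * b); rewrite fM; split=> //; exists a, b.
Qed.

Lemma img_setstar A y : img f (setstar A) y <-> setstar (img f A) y.
Proof.
split=> [[_ [[s [hs ->]] ->]]|[s [hs ->]]].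
  exists (map f s); split=> [_ /mapP[a /hs Aa ->]|]; first by exists a.
  by rewrite big_map; elim: s {hs} => [|a s IH]; rewrite ?big_nil ?big_cons // fM IH.
elim: s hs => [|b s IH] hs.
  by exists 1; split; rewrite ?big_nil //; exists [::]; rewrite big_nil.
have [a [Aa ->]] := hs b (mem_head b s).
have [|_ [[t [ht ->]] fs]] := IH; first by move=> z zs; apply: hs; rewrite inE zs orbT.
exists (\prod_(a <- a :: t) a); split.
  by exists (a :: t); split=> // z; rewrite inE => /orP[/eqP->|/ht].
by rewrite !big_cons fM -fs.
Qed.

Lemma img_regular A : regular A -> regular (img f A).
Proof.
elim=> {A} [|a|A B _ rA _ rB|A B _ rA _ rB|A _ rA|A B _ rA AB].
- by apply: (reg_ext (reg_empty E)) => y; split=> // -[x []].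
- by apply: (reg_ext (reg_single (f a))) => y; split=> [->|[x [-> ->]]]; first exists a.
- apply: (reg_ext (reg_union rA rB)) => y; split=> [[[x [Ax ->]]|[x [Bx ->]]]|].
  + by exists x; split; [left|].
  + by exists x; split; [right|].
  + by move=> [x [[Ax|Bx] ->]]; [left|right]; exists x.
- apply: (reg_ext (reg_mul rA rB)) => y; symmetry; exact: img_setmul.
- apply: (reg_ext (reg_star rA)) => y; symmetry; exact: img_setstar.
- by apply: (reg_ext rA) => y; split=> -[x [/AB Ax ->]]; exists x.
Qed.

End Images.

Lemma Rmorph_id (D : pzSemiRingType) : Rmorph (@id D).
Proof.
split=> //; split=> //; split=> //; split=> // A s _.
by apply: is_lub_ext => x; split=> [Ax|[y [Ay ->]]]; first exists x.
Qed.

Lemma Rmorph_comp (D E F : pzSemiRingType) (f : D -> E) (g : E -> F) :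
  Rmorph f -> Rmorph g -> Rmorph (g \o f).
Proof.
move=> [f0 [f1 [fD [fM fL]]]] [g0 [g1 [gD [gM gL]]]].
split; first by rewrite /= f0.
split; first by rewrite /= f1.
split; first by move=> a b; rewrite /= fD.
split; first by move=> a b; rewrite /= fM.
move=> A s rA lA.
apply: is_lub_ext (gL _ _ (img_regular f1 fM rA) (fL _ _ rA lA)) => z.
by split=> [[_ [[x [Ax ->]] ->]]|[x [Ax ->]]]; [exists x|exists (f x); split=> //; exists x].
Qed.

Lemma Rmorph_kstar (D E : pzSemiRingType) (f : D -> E) a :
  Rdioid D -> Rdioid E -> Rmorph f -> f (kstar a) = kstar (f a).
Proof.
move=> HD HE [_ [f1 [_ [fM fL]]]].
apply: (is_lub_uniq (A := setstar (fun x => x = f a))) (is_lub_kstar HE _).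
have := fL _ _ (reg_star (reg_single a)) (is_lub_kstar HD a).
apply: is_lub_ext => y; rewrite -/(img _ _ y) img_setstar //.
split=> -[s [hs ->]]; exists s; split=> // z /hs; last by move=> ->; exists a.
by case=> x [-> ->].
Qed.

(** * Subsemirings closed under star *)

Section SubDioid.
Variables (D : pzSemiRingType) (P : semiringClosed D).

Record subdioid := SubDioid {subdioid_val : D; _ : subdioid_val \in P}.

HB.instance Definition _ := [isSub for subdioid_val].
HB.instance Definition _ := [Choice of subdioid by <:].
HB.instance Definition _ :=
  GRing.SubChoice_isSubPzSemiRing.Build _ _ subdioid (semiringClosedP _).

Hypothesis HD : Rdioid D.
Hypothesis Pstar : forall a, a \in P -> kstar a \in P.

Local Notation vimg := (img (fun x : subdioid => val x)).

Lemma dle_val (a b : subdioid) : dle a b <-> dle (val a) (val b).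
Proof.
rewrite /dle; split=> [ab|ab]; first by rewrite -rmorphD ab.
by apply: val_inj; rewrite rmorphD.
Qed.

(** For arbitrary sets only this direction is available; the converse, for regular sets, needs their
    suprema in [D] to lie in [P]. *)
Lemma is_lub_val (A : subdioid -> Prop) (s : subdioid) :
  is_lub (vimg A) (val s) -> is_lub A s.
Proof.
move=> [ub lub]; split=> [a Aa|u hu]; apply/dle_val.
  by apply: ub; exists a.
by apply: lub => _ [a [Aa ->]]; apply/dle_val/hu.
Qed.

Lemma img_val_regular (A : subdioid -> Prop) : regular A -> regular (vimg A).
Proof. by apply: img_regular; [exact: rmorph1|exact: rmorphM]. Qed.

(** Induction on the construction of [A]: its supremum in [D] is built from elements of [P] by [0],
    [+], [*] and [kstar], hence stays in [P]. *)
Lemma subdioid_lub (A : subdioid -> Prop) : regular A ->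
  exists s : subdioid, is_lub (vimg A) (val s).
Proof.
elim=> {A} [|a|A B _ [a la] _ [b lb]|A B rA [a la] rB [b lb]|A rA [a la]|A B _ [a la] AB].
- by exists 0; split=> [x [? []]//|u _]; rewrite rmorph0; apply: dle0x.
- exists a; apply: is_lub_ext (is_lub_single HD (val a)) => y.
  by split=> [->|[x [-> ->]]]; first exists a.
- exists (a + b); rewrite rmorphD; apply: is_lub_ext (is_lub_union HD la lb) => y.
  split=> [[[x [Ax ->]]|[x [Bx ->]]]|[x [[Ax|Bx] ->]]].
  + by exists x; split; [left|].
  + by exists x; split; [right|].
  + by left; exists x.
  + by right; exists x.
- exists (a * b); rewrite rmorphM.
  apply: is_lub_ext (is_lub_mul HD (img_val_regular rA) (img_val_regular rB) la lb) => y.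
  by symmetry; apply: img_setmul; exact: rmorphM.
- exists (SubDioid (Pstar (valP a))).
  apply: is_lub_ext (is_lub_star HD (img_val_regular rA) la) => y.
  by symmetry; apply: img_setstar; [exact: rmorph1|exact: rmorphM].
- by exists a; apply: is_lub_ext la => y; split=> -[x [/AB Ax ->]]; exists x.
Qed.

Lemma subdioid_is_lub (A : subdioid -> Prop) s : regular A -> is_lub A s ->
  is_lub (vimg A) (val s).
Proof.
move=> /subdioid_lub[t lt] ls; suff -> : s = t by [].
have [ub lub] := ls; have [ub' lub'] := is_lub_val lt; apply: val_inj.
by apply: (dle_anti (D := D)); apply/dle_val; [apply: lub|apply: lub'].
Qed.

Lemma subdioid_Rdioid : Rdioid subdioid.
Proof.
split; first by move=> a; apply: val_inj; rewrite rmorphD dioid_addxx.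
split=> [A /subdioid_lub[s ls]|A B a b rA rB la lb]; first by exists s; apply: is_lub_val.
apply: is_lub_val; rewrite rmorphM.
apply: is_lub_ext (is_lub_mul HD (img_val_regular rA) (img_val_regular rB)
  (subdioid_is_lub rA la) (subdioid_is_lub rB lb)) => y.
by symmetry; apply: img_setmul; exact: rmorphM.
Qed.

Lemma subdioid_val_Rmorph : Rmorph (fun x : subdioid => val x).
Proof.
split; first exact: rmorph0.
split; first exact: rmorph1.
split; first exact: rmorphD.
split; first exact: rmorphM.
exact: subdioid_is_lub.
Qed.

Lemma corestrict_Rmorph (E : pzSemiRingType) (f : E -> D) (fP : forall x, f x \in P) :
  Rmorph f -> Rmorph (fun x => SubDioid (fP x)).
Proof.
move=> [f0 [f1 [fD [fM fL]]]].
split; first by apply: val_inj; rewrite rmorph0.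
split; first by apply: val_inj; rewrite rmorph1.
split; first by move=> a b; apply: val_inj; rewrite rmorphD; apply: fD.
split; first by move=> a b; apply: val_inj; rewrite rmorphM; apply: fM.
move=> A s rA lA; apply: is_lub_val; apply: is_lub_ext (fL _ _ rA lA) => y.
split=> [[x [Ax ->]]|[_ [[x [Ax ->]] ->]]]; last by exists x.
by exists (SubDioid (fP x)); split=> //; exists x.
Qed.

End SubDioid.

(** * Induction from generators *)

Definition Kclosed (D : pzSemiRingType) (P : D -> Prop) : Prop :=
  [/\ P 0, P 1, forall a b, P a -> P b -> P (a + b),
      forall a b, P a -> P b -> P (a * b) & forall a, P a -> P (kstar a)].

(** Excluded middle turns [P] into the boolean predicate that [semiringClosed] requires. *)
Lemma Kclosed_semiring (D : pzSemiRingType) (P : D -> Prop) : Kclosed P ->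
  exists Q : semiringClosed D, forall x, x \in Q <-> P x.
Proof.
move=> [P0 P1 PD PM _].
pose Pb : pred D := fun x => if excluded_middle_informative (P x) then true else false.
have PbP x : x \in Pb <-> P x.
  by rewrite /Pb unfold_in; case: excluded_middle_informative.
have cl : semiring_closed Pb.
  split; split; try exact/PbP; move=> a b /PbP Pa /PbP Pb'; apply/PbP.
    exact: PD.
  exact: PM.
pose mix := GRing.isSemiringClosed.Build D Pb cl.
pose Q : semiringClosed D := HB.pack Pb mix.
by exists Q.
Qed.

(** The universal map into the sub-R-dioid given by [P], followed by the inclusion, fixes the
    generators; by uniqueness it is the identity, so every [c] satisfies [P]. *)
Lemma C2_ind (C : pzSemiRingType) (p0 p1 q0 q1 : C) (P : C -> Prop) :
  is_C2 p0 p1 q0 q1 -> Kclosed P -> P p0 -> P p1 -> P q0 -> P q1 -> forall c, P c.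
Proof.
move=> [HC [e00 [e01 [e10 [e11 univ]]]]] KP Pp0 Pp1 Pq0 Pq1 c.
have [Q QP] := Kclosed_semiring KP; apply/QP.
have Qs a : a \in Q -> kstar a \in Q.
  by case: KP => _ _ _ _ Ps /QP Pa; apply/QP/Ps.
move/QP in Pp0; move/QP in Pp1; move/QP in Pq0; move/QP in Pq1.
have [||||h [[hR [h1 [h2 [h3 h4]]]] _]] := univ _ (SubDioid Pp0) (SubDioid Pp1)
  (SubDioid Pq0) (SubDioid Pq1) (subdioid_Rdioid HC Qs).
1-4: by apply: val_inj; rewrite rmorphM ?rmorph0 ?rmorph1.
have [g [_ gU]] := univ _ p0 p1 q0 q1 HC e00 e01 e10 e11.
rewrite (_ : c = val (h c)); first exact: valP.
rewrite [LHS](gU id) //; last exact: Rmorph_id.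
symmetry; apply: (gU (val \o h)); rewrite /= ?h1 ?h2 ?h3 ?h4 //.
exact/Rmorph_comp/subdioid_val_Rmorph.
Qed.

(** The same uniqueness argument, with [iK] and [iC] corestricted to [P]. *)
Lemma Rtensor_ind (K C T : pzSemiRingType) (iK : K -> T) (iC : C -> T) (P : T -> Prop) :
  is_Rtensor iK iC -> Kclosed P -> (forall k, P (iK k)) -> (forall c, P (iC c)) ->
  forall t, P t.
Proof.
move=> [HT [RK [RC [comm univ]]]] KP PK PC t.
have [Q QP] := Kclosed_semiring KP; apply/QP.
have Qs a : a \in Q -> kstar a \in Q.
  by case: KP => _ _ _ _ Ps /QP Pa; apply/QP/Ps.
have QK k : iK k \in Q by apply/QP.
have QC c : iC c \in Q by apply/QP.
have [|h [[hR [hK hC]] _]] := univ _ _ _ (subdioid_Rdioid HT Qs)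
  (corestrict_Rmorph QK RK) (corestrict_Rmorph QC RC).
  by move=> k c; apply: val_inj; rewrite !rmorphM; apply: comm.
have [g [_ gU]] := univ _ _ _ HT RK RC comm.
rewrite (_ : t = val (h t)); first exact: valP.
rewrite [LHS](gU id) //; last exact: Rmorph_id.
symmetry; apply: (gU (val \o h)) => [|k|c]; rewrite /= ?hK ?hC //.
exact/Rmorph_comp/subdioid_val_Rmorph.
Qed.

(** * Bracket words *)

Section Automata.
Variables (C T : pzSemiRingType) (iC : C -> T).
Hypotheses (HT : Rdioid T) (iCR : Rmorph iC).

Lemma iC0 : iC 0 = 0. Proof. by case: iCR. Qed.
Lemma iC1 : iC 1 = 1. Proof. by case: iCR => _ []. Qed.
Lemma iCM a b : iC (a * b) = iC a * iC b. Proof. by case: iCR => _ [_ [_ []]]. Qed.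

Lemma inZ0 : inZ iC 0. Proof. by move=> c; rewrite mul0r mulr0. Qed.
Lemma inZ1 : inZ iC 1. Proof. by move=> c; rewrite mul1r mulr1. Qed.

Lemma inZD x y : inZ iC x -> inZ iC y -> inZ iC (x + y).
Proof. by move=> hx hy c; rewrite mulrDl mulrDr hx hy. Qed.

Lemma inZM x y : inZ iC x -> inZ iC y -> inZ iC (x * y).
Proof. by move=> hx hy c; rewrite -mulrA hy !mulrA hx. Qed.

(** Entries are coded in [option bool] so that one matrix can be read with different brackets. *)
Definition code (p : bool -> C) (o : option bool) : T :=
  if o is Some b then iC (p b) else 0.

Definition central m n (X : 'M[T]_(m, n)) := forall i j, inZ iC (X i j).

Definition bits m n (X : 'M[T]_(m, n)) := forall i j, X i j = 0 \/ X i j = 1.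

Lemma bits_central m n (X : 'M[T]_(m, n)) : bits X -> central X.
Proof. by move=> h i j; case: (h i j) => ->; [apply: inZ0|apply: inZ1]. Qed.

Lemma centralM m n k (X : 'M[T]_(m, n)) (Y : 'M[T]_(n, k)) :
  central X -> central Y -> central (X *m Y).
Proof.
move=> hX hY i j; rewrite mxE; elim/big_ind: _ => [|x y|l _].
- exact: inZ0.
- exact: inZD.
- exact: inZM.
Qed.

Lemma centralD m n (X Y : 'M[T]_(m, n)) : central X -> central Y -> central (X + Y).
Proof. by move=> hX hY i j; rewrite mxE; apply: inZD. Qed.

Lemma central0 m n : central (0 : 'M[T]_(m, n)).
Proof. by move=> i j; rewrite mxE; apply: inZ0. Qed.

Lemma bits0 m n : bits (0 : 'M[T]_(m, n)).
Proof. by move=> i j; rewrite mxE; left. Qed.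

Lemma bits1 n : bits (1%:M : 'M[T]_n).
Proof. by move=> i j; rewrite mxE; case: eqP => _; [right|left]. Qed.

Lemma bits_row m n1 n2 (X : 'M[T]_(m, n1)) (Y : 'M[T]_(m, n2)) :
  bits X -> bits Y -> bits (row_mx X Y).
Proof. by move=> hX hY i j; rewrite mxE; case: split. Qed.

Lemma bits_col m1 m2 n (X : 'M[T]_(m1, n)) (Y : 'M[T]_(m2, n)) :
  bits X -> bits Y -> bits (col_mx X Y).
Proof. by move=> hX hY i j; rewrite mxE; case: split. Qed.

Lemma central_block m1 m2 n1 n2 (X : 'M[T]_(m1, n1)) (Y : 'M[T]_(m1, n2))
    (Z : 'M[T]_(m2, n1)) (W : 'M[T]_(m2, n2)) :
  central X -> central Y -> central Z -> central W -> central (block_mx X Y Z W).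
Proof. by move=> *; move=> i j; rewrite mxE; case: split => ?; rewrite mxE; case: split. Qed.

Definition automx (p q : bool -> C) n m (u : 'M[option bool]_(n, m)) X v : 'M[T]_(n, m) :=
  map_mx (code p) u + X + map_mx (code q) v.

Section Dyck.
(* [e b], [f b] are brackets like [p b], [q b] that leave room for an extra pair
   [e0], [f0] delimiting words. *)
Variables (e0 f0 : C) (e f : bool -> C).
Hypotheses (ef00 : e0 * f0 = 1) (ef0 : forall b, e0 * f b = 0)
  (e0f : forall b, e b * f0 = 0) (efE : forall a b, e a * f b = (a == b)%:R).
Variables p q : bool -> C.
Hypothesis pqE : forall a b, p a * q b = (a == b)%:R.

(* [s] is the stack of brackets still open, and [w] is [w'] with [e b], [f b]
   replaced by [p b], [q b]. The factor [c] is what makes the matrix of balanced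
   runs transitive ([c = e0]) and closed under nesting ([c = e0 * e b]). *)
Definition simulates (w' w : T) : Prop := forall s : seq bool,
  let t := iC (e0 * \prod_(b <- s) e b) * w' * iC f0 in
  inZ iC t /\ forall c, dle (t * iC c) (iC (c * \prod_(b <- s) p b) * w).

Inductive letter : T -> T -> Prop :=
| letter_open b : letter (iC (e b)) (iC (p b))
| letter_close b : letter (iC (f b)) (iC (q b))
| letter_central x : inZ iC x -> letter x x.

Lemma letter_code_open o : letter (code e o) (code p o).
Proof. by case: o => [b|]; [apply: letter_open|apply/letter_central/inZ0]. Qed.

Lemma letter_code_close o : letter (code f o) (code q o).
Proof. by case: o => [b|]; [apply: letter_close|apply/letter_central/inZ0]. Qed.

Lemma simulates1 : simulates 1 1.
Proof.
(* The innermost open bracket is the last entry of [s]. With nothing open, [e0 * f0 = 1]; otherwise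
   [e b * f0 = 0] kills the word. *)
case/lastP=> [|s b]; rewrite /= ?big_rcons /=.
  rewrite !big_nil !mulr1 -iCM ef00 iC1; split=> [|c]; first exact: inZ1.
  by rewrite mul1r !mulr1; apply: dle_refl.
rewrite mulr1 -iCM -!mulrA e0f !mulr0 iC0; split=> [|c]; first exact: inZ0.
by rewrite mul0r; apply: dle0x.
Qed.

(** An opening bracket is pushed on the stack. A closing one cancels a matching top, and gives [0]
    against [e0] or a different bracket. A central letter moves out to the front. *)
Lemma simulates_letter a' a w' w :
  letter a' a -> simulates w' w -> simulates (a' * w') (a * w).
Proof.
case=> {a' a} [b|b|x hx] sim.
- move=> s; have := sim (rcons s b).
  rewrite !big_rcons /= !iCM !mulrA => -[hz hc]; split=> // c.
  by have := hc c; rewrite !iCM !mulrA.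
- case/lastP=> [|s a]; rewrite /= ?big_rcons /=.
    rewrite big_nil mulr1 mulrA -iCM ef0 iC0 !mul0r; split=> [|c]; first exact: inZ0.
    by rewrite mul0r; apply: dle0x.
  rewrite !mulrA -iCM -!mulrA efE.
  case: eqP => [->|_]; last first.
    rewrite !mulr0 iC0 !mul0r; split=> [|c]; first exact: inZ0.
    by rewrite mul0r; apply: dle0x.
  rewrite mulr1 !mulrA; have [hz hc] := sim s; split=> // c.
  apply: dle_trans (hc c) _; apply: dle_eq => //.
  by rewrite !mulrA -iCM -!mulrA pqE eqxx mulr1.
- move=> s /=; have [hz hc] := sim s.
  have -> : iC (e0 * \prod_(b <- s) e b) * (x * w') * iC f0 =
      x * (iC (e0 * \prod_(b <- s) e b) * w' * iC f0).
    by rewrite !mulrA -hx.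
  split=> [|c]; first exact: inZM.
  by rewrite -mulrA [X in dle _ X]mulrA -hx -[X in dle _ X]mulrA; apply: dle_mul2l.
Qed.

Lemma dyck_star n (u v : 'M[option bool]_n) X :
  central X ->
  let A' := automx e f u X v in let A := automx p q u X v in
  forall i j, inZ iC (iC e0 * mxstar A' i j * iC f0) /\
    forall c, dle (iC e0 * mxstar A' i j * iC f0 * iC c) (iC c * mxstar A i j).
Proof.
move=> hX A' A.
(* Words enter only through their action on [simulates], so concatenation becomes composition. The
   bound on [w] carries estimates over to the star of [A]; the one on [w'] is what the centrality
   argument needs. *)
pose W i j w' := exists w, [/\ dle w' (mxstar A' i j), dle w (mxstar A i j) &
  forall t' t, simulates t' t -> simulates (w' * t') (w * t)].
have W1 i : W i i 1.
  have le1 (B : 'M[T]_n) : dle 1 (mxstar B i i).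
    have /mxleP/(_ i i) := mxstar_ge1 HT B.
    by rewrite mxE eqxx.
  by exists 1; split=> // t' t; rewrite !mul1r.
have WM i j k a b : W i j a -> W j k b -> W i k (a * b).
  have leM (B : 'M[T]_n) x y :
      dle x (mxstar B i j) -> dle y (mxstar B j k) -> dle (x * y) (mxstar B i k).
    move=> hx hy; apply: dle_trans (dle_mul hx hy) _.
    by have /mxle_mulP := mxstar_mulxx HT B; apply.
  move=> [a' [la la' ha]] [b' [lb lb' hb]]; exists (a' * b'); split; [exact: leM|exact: leM|].
  by move=> t' t /hb/ha; rewrite !mulrA.
have WA : mxapprox A' W.
  have leA (B : 'M[T]_n) i j x : dle x (B i j) -> dle x (mxstar B i j).
    by move=> h; apply: dle_trans h _; have /mxleP := mxstar_ge HT B; apply.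
  have split3 (o o' : bool -> C) i j : automx o o' u X v i j =
    code o (u i j) + X i j + code o' (v i j) by rewrite !mxE.
  have WL i j a' a : dle a' (A' i j) -> dle a (A i j) -> letter a' a ->
      approx a' (W i j).
    move=> la' la hl; apply: approx_mem; exists a; split; [exact: leA|exact: leA|].
    by move=> t' t; apply: simulates_letter.
  have le1 (x y z : T) : dle x (x + y + z) by rewrite -addrA; apply: dle_addl.
  have le2 (x y z : T) : dle y (x + y + z) by rewrite addrAC; apply: dle_addr.
  have le3 (x y z : T) : dle z (x + y + z) by apply: dle_addr.
  move=> i j; rewrite split3; apply: approxD => //; first apply: approxD => //.
  - by apply: (WL _ _ _ (code p (u i j))); rewrite ?split3 //; apply: letter_code_open.
  - by apply: (WL _ _ _ (X i j)); rewrite ?split3 //; apply: letter_central.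
  - by apply: (WL _ _ _ (code q (v i j))); rewrite ?split3 //; apply: letter_code_close.
have Wsim i j w' : W i j w' -> inZ iC (iC e0 * w' * iC f0) /\
    forall c, dle (iC e0 * w' * iC f0 * iC c) (iC c * mxstar A i j).
  (* Acting on the empty word, with the empty stack, gives a statement about [w'] alone. *)
  move=> [w [_ lw /(_ _ _ simulates1)/(_ [::])]].
  rewrite !big_nil !mulr1 => -[hz hc]; split=> // c.
  by apply: dle_trans (hc c) _; rewrite !mulr1; apply: dle_mul2l.
move=> i j; have ap := mxstar_approx HT W1 WM WA (i := i) (j := j).
split=> [c|c]; last first.
  rewrite -mulrA; apply: ap => w' /Wsim[_ hc].
  by rewrite mulrA.
(* Each inequality is checked on words [w'], which are central once delimited; then [w'] is enlarged
   to the star entry. *)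
apply: dle_anti.
  rewrite -mulrA; apply: ap => w' Ww; have [hz _] := Wsim _ _ _ Ww.
  rewrite mulrA hz !mulrA; apply/dle_mul2r/dle_mul2l.
  by case: Ww => w [].
rewrite !mulrA; apply: ap => w' Ww; have [hz _] := Wsim _ _ _ Ww.
rewrite -!mulrA (mulrA (iC e0)) (mulrA _ (iC f0)) -hz !mulrA.
do 2!apply: dle_mul2r; apply: dle_mul2l.
by case: Ww => w [].
Qed.

End Dyck.
End Automata.

(** * Automata and the normal form *)

Section Recognizable.
Variables (C T : pzSemiRingType) (iC : C -> T) (p q : bool -> C).
Hypothesis HT : Rdioid T.

Lemma automx_block m1 m2 n1 n2 (u1 v1 : 'M[option bool]_(m1, n1)) X1
    (u2 v2 : 'M[option bool]_(m1, n2)) X2 (u3 v3 : 'M[option bool]_(m2, n1)) X3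
    (u4 v4 : 'M[option bool]_(m2, n2)) X4 :
  automx iC p q (block_mx u1 u2 u3 u4) (block_mx X1 X2 X3 X4) (block_mx v1 v2 v3 v4) =
  block_mx (automx iC p q u1 X1 v1) (automx iC p q u2 X2 v2)
           (automx iC p q u3 X3 v3) (automx iC p q u4 X4 v4).
Proof. by rewrite /automx !map_block_mx !add_block_mx. Qed.

Lemma automx_None m n (X : 'M[T]_(m, n)) :
  automx iC p q (const_mx None) X (const_mx None) = X.
Proof. by apply/matrixP => i j; rewrite !mxE /= add0r addr0. Qed.

Definition recognizable (phi : T) : Prop :=
  exists n (S : 'M[T]_(1, n)) (F : 'M[T]_(n, 1)) (u v : 'M[option bool]_n) X,
    [/\ (0 < n)%N, bits S, bits F, central iC X &
        phi = (S *m mxstar (automx iC p q u X v) *m F) ord0 ord0].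

Lemma mxstar0 n : mxstar (0 : 'M[T]_n) = 1%:M.
Proof. by rewrite -mxstar_unfold // mul0mx addr0. Qed.

(** With [G = 0] this yields sums; with [S2 = 0] and [F1 = 0] it yields products and single
    edges. *)
Lemma mul_row_star_col m n (S1 : 'rV[T]_m) (S2 : 'rV[T]_n) (A : 'M[T]_m) (G : 'M[T]_(m, n))
    (B : 'M[T]_n) (F1 : 'cV[T]_m) (F2 : 'cV[T]_n) :
  row_mx S1 S2 *m mxstar (block_mx A G 0 B) *m col_mx F1 F2 =
  S1 *m mxstar A *m (G *m mxstar B *m F2 + F1) + S2 *m mxstar B *m F2.
Proof. by rewrite -mulmxA mxstar_block_upper // mul_row_col !mulmxA. Qed.

(** A two-state automaton with one edge; choices of [o], [x], [o'] give [0], [1], the central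
    elements and all brackets. *)
Lemma recognizable_letter o x o' : inZ iC x ->
  recognizable (code iC p o + x + code iC q o').
Proof.
move=> hx; exists (1 + 1)%N, (row_mx (1%:M : 'M[T]_1) (0 : 'M[T]_1)),
  (col_mx (0 : 'M[T]_1) (1%:M : 'M[T]_1)).
exists (block_mx (const_mx None) (const_mx o) (const_mx None) (const_mx None)).
exists (block_mx (const_mx None) (const_mx o') (const_mx None) (const_mx None)).
exists (block_mx 0 (const_mx x) 0 0); split=> //.
- by apply: bits_row; [apply: bits1|apply: bits0].
- by apply: bits_col; [apply: bits0|apply: bits1].
- by apply: central_block; try exact: central0; move=> i j; rewrite mxE.
rewrite automx_block !automx_None mul_row_star_col.
rewrite !mxstar0 !mul0mx !mul1mx !mulmx1 !addr0.
by rewrite /automx !mxE.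
Qed.

Lemma recognizableD a b : recognizable a -> recognizable b -> recognizable (a + b).
Proof.
move=> [n1 [S1 [F1 [u1 [v1 [X1 [n1_gt0 hS1 hF1 hX1 ->]]]]]]].
move=> [n2 [S2 [F2 [u2 [v2 [X2 [n2_gt0 hS2 hF2 hX2 ->]]]]]]].
exists (n1 + n2)%N, (row_mx S1 S2), (col_mx F1 F2).
exists (block_mx u1 (const_mx None) (const_mx None) u2).
exists (block_mx v1 (const_mx None) (const_mx None) v2).
exists (block_mx X1 0 0 X2); split=> //.
- by rewrite addn_gt0 n1_gt0.
- exact: bits_row.
- exact: bits_col.
- by apply: central_block => //; apply: central0.
rewrite automx_block !automx_None mul_row_star_col.
by rewrite !mul0mx add0r [in RHS]mxE.
Qed.

Lemma recognizableM a b : recognizable a -> recognizable b -> recognizable (a * b).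
Proof.
move=> [n1 [S1 [F1 [u1 [v1 [X1 [n1_gt0 hS1 hF1 hX1 ->]]]]]]].
move=> [n2 [S2 [F2 [u2 [v2 [X2 [n2_gt0 hS2 hF2 hX2 ->]]]]]]].
exists (n1 + n2)%N, (row_mx S1 0), (col_mx 0 F2).
exists (block_mx u1 (const_mx None) (const_mx None) u2).
exists (block_mx v1 (const_mx None) (const_mx None) v2).
(* Final states of the first automaton are linked to initial states of the second; the link is a
   product of 0-1 matrices, hence central. *)
exists (block_mx X1 (F1 *m S2) 0 X2); split=> //.
- by rewrite addn_gt0 n1_gt0.
- by apply: bits_row => //; apply: bits0.
- by apply: bits_col => //; apply: bits0.
- apply: central_block => //; last exact: central0.
  by apply: centralM; apply: bits_central.
rewrite automx_block !automx_None mul_row_star_col.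
by rewrite !mul0mx !addr0 -2!(mulmxA F1) mulmxA [in RHS]mxE big_ord1.
Qed.

Lemma recognizable_kstar a : recognizable a -> recognizable (kstar a).
Proof.
move=> [n [S [F [u [v [X [n_gt0 hS hF hX Ea]]]]]]].
(* Feedback yields [a * kstar a], so the unit is recognized separately. *)
rewrite -kstar_unfold //; apply: recognizableD.
  have := recognizable_letter None None (@inZ1 _ _ iC).
  by rewrite /= add0r addr0.
exists n, S, F, u, v, (X + F *m S); split=> //.
  by apply: centralD => //; apply: centralM; apply: bits_central.
have -> : automx iC p q u (X + F *m S) v = automx iC p q u X v + F *m S.
  by rewrite /automx -!addrA; congr (_ + (_ + _)); rewrite addrC.
rewrite -mulmxA mxstar_feedback // !mulmxA mxE big_ord1 -Ea; congr (_ * _).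
by rewrite mxstar11 -Ea.
Qed.

Lemma recognizable_Kclosed : Kclosed recognizable.
Proof.
split; [| |exact: recognizableD|exact: recognizableM|exact: recognizable_kstar].
  have := recognizable_letter None None (@inZ0 _ _ iC).
  by rewrite /= !addr0.
have := recognizable_letter None None (@inZ1 _ _ iC).
by rewrite /= add0r addr0.
Qed.

End Recognizable.

Lemma Kclosed_preim (C T : pzSemiRingType) (f : C -> T) (P : T -> Prop) :
  Rdioid C -> Rdioid T -> Rmorph f -> Kclosed P -> Kclosed (fun c => P (f c)).
Proof.
move=> HC HT fR [P0 P1 PD PM Ps]; have [f0 [f1 [fD [fM _]]]] := fR.
split=> [||a b|a b|a]; rewrite ?f0 ?f1 ?fD ?fM ?Rmorph_kstar //.
- exact: PD.
- exact: PM.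
- exact: Ps.
Qed.

(** Images of [K] are central as they commute with those of [C]; images of [C] are reached from the
    brackets by pulling [recognizable] back along [iC]. *)
Lemma Rtensor_recognizable (K C T : pzSemiRingType) (p q : bool -> C)
    (iK : K -> T) (iC : C -> T) :
  is_C2 (p false) (p true) (q false) (q true) -> is_Rtensor iK iC ->
  forall t, recognizable iC p q t.
Proof.
move=> HC2 Htens; have [HC _] := HC2; have [HT [_ [RC [comm _]]]] := Htens.
have RK : Kclosed (recognizable iC p q) by apply: recognizable_Kclosed.
apply: (Rtensor_ind Htens RK) => [k|].
  have := recognizable_letter p q HT None None (comm k).
  by rewrite /= add0r addr0.
have Pp b : recognizable iC p q (iC (p b)).
  have := recognizable_letter p q HT (Some b) None (@inZ0 _ _ iC).
  by rewrite /= !addr0.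
have Pq b : recognizable iC p q (iC (q b)).
  have := recognizable_letter p q HT None (Some b) (@inZ0 _ _ iC).
  by rewrite /= !add0r.
by apply: (C2_ind HC2 (Kclosed_preim HC HT RC RK)).
Qed.

(** * The central matrix of balanced runs *)

Section DyckMatrix.
Variables (C T : pzSemiRingType) (iC : C -> T).
Hypotheses (HT : Rdioid T) (RC : Rmorph iC).
Variables (e0 f0 : C) (e f p q : bool -> C).
Hypotheses (ef00 : e0 * f0 = 1) (ef0 : forall b, e0 * f b = 0)
  (e0f : forall b, e b * f0 = 0) (efE : forall a b, e a * f b = (a == b)%:R)
  (pqE : forall a b, p a * q b = (a == b)%:R).
Variables (n : nat) (u v : 'M[option bool]_n) (X : 'M[T]_n).
Hypothesis hX : central iC X.

Local Notation A' := (automx iC e f u X v).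
Local Notation A := (automx iC p q u X v).

Definition dyckmx : 'M[T]_n := \matrix_(i, j) (iC e0 * mxstar A' i j * iC f0).

(** Here the simulation compares [A'] with itself, [e] and [f] standing in for [p] and [q]. *)
Lemma dyckmx_central : central iC dyckmx.
Proof. by move=> i j; rewrite mxE; case: (dyck_star HT RC ef00 ef0 e0f efE efE u v hX i j). Qed.

(** A central entry passes through the delimiter, leaving [e0 * f0 = 1]. *)
Lemma dyckmx_ge (Y : 'M[T]_n) : central iC Y -> mxle Y (mxstar A') -> mxle Y dyckmx.
Proof.
move=> hY /mxleP YA; apply/mxleP => i j; rewrite mxE.
have -> : Y i j = iC e0 * Y i j * iC f0 by rewrite -hY -mulrA -(iCM RC) ef00 (iC1 RC) mulr1.
exact/dle_mul2r/dle_mul2l.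
Qed.

Lemma dyckmx_ge1 : mxle 1%:M dyckmx.
Proof.
apply: dyckmx_ge; last exact: mxstar_ge1.
by apply: bits_central; apply: bits1.
Qed.

Lemma dyckmx_geX : mxle X dyckmx.
Proof.
apply: dyckmx_ge => //; apply: mxle_trans (mxstar_ge HT _).
by rewrite /automx addrAC; apply: mxle_addr.
Qed.

(** The simulation with [c = e0] replaces the first factor, followed by the second [e0], by [e0]
    times a star entry; the two star entries then merge. *)
Lemma dyckmx_mul : mxle (dyckmx *m dyckmx) dyckmx.
Proof.
apply/mxle_mulP => // i j k; rewrite !mxE !mulrA.
have [_ /(_ e0) h] := dyck_star HT RC ef00 ef0 e0f efE efE u v hX i j.
apply: dle_mul2r; apply: (dle_trans (dle_mul2r _ h)).
rewrite -mulrA; apply: dle_mul2l.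
by have /mxle_mulP := mxstar_mulxx HT A'; apply.
Qed.

(** By centrality the outer brackets meet and give [0] or [1]. A matching pair is rewritten as
    [1 = e0 * e a * f b * f0], and the simulation with [c = e0 * e a] moves the balanced run inside
    this pair. *)
Lemma dyckmx_nest : mxle (map_mx (code iC p) u *m dyckmx *m map_mx (code iC q) v) dyckmx.
Proof.
have hN := dyckmx_central.
apply/mxle_mulP => // i k l; rewrite mxE mulr_suml; apply: dle_sum => // j.
rewrite [map_mx _ u _ _]mxE [map_mx _ v _ _]mxE.
case Eu: (u i j) => [a|] /=; last by rewrite !mul0r; apply: dle0x.
case Ev: (v k l) => [b|] /=; last by rewrite mulr0; apply: dle0x.
rewrite -hN -mulrA -(iCM RC) pqE; case: eqP => [ab|_]; last first.
  by rewrite (iC0 RC) mulr0; apply: dle0x.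
have -> : iC 1%:R = iC (e0 * e a) * iC (f b * f0).
  by rewrite -(iCM RC) -mulrA (mulrA (e a)) efE ab eqxx mul1r ef00.
rewrite mulrA hN; have [_ /(_ (e0 * e a)) h] := dyck_star HT RC ef00 ef0 e0f efE efE u v hX j k.
rewrite -hN {1}mxE; apply: (dle_trans (dle_mul2r _ h)).
rewrite mxE !(iCM RC) -!mulrA; apply: dle_mul2l; rewrite !mulrA; apply: dle_mul2r.
have /(mxle_mulP HT) sA := mxstar_mull HT A'.
have /(mxle_mulP HT) sB := mxstar_mulxx HT A'.
have /mxleP sG := mxstar_ge HT A'.
have hu : dle (iC (e a)) (A' i j).
  by rewrite !mxE Eu -addrA; apply: dle_addl.
have hv : dle (iC (f b)) (mxstar A' k l).
  by apply: dle_trans (sG _ _); rewrite !mxE Ev; apply: dle_addr.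
apply: dle_trans (sB i k l); apply: dle_mul => //.
by apply: dle_trans (sA i j k); apply: dle_mul2r.
Qed.

(** The simulation with the original brackets [p], [q] as target and [c = 1]. *)
Lemma dyckmx_le_star : mxle dyckmx (mxstar A).
Proof.
apply/mxleP => i j; rewrite mxE.
have [_ /(_ 1)] := dyck_star HT RC ef00 ef0 e0f efE pqE u v hX i j.
by rewrite (iC1 RC) mulr1 mul1r.
Qed.

End DyckMatrix.

Theorem theorem10 (K C T : pzSemiRingType) (p0 p1 q0 q1 : C)
    (iK : K -> T) (iC : C -> T) :
  Rdioid K -> is_C2 p0 p1 q0 q1 -> is_Rtensor iK iC ->
  forall phi : T,
  exists (n : nat) (S : 'M[T]_(1, n)) (F : 'M[T]_(n, 1))
         (U V N : 'M[T]_n),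
    (0 < n)%N /\
    (forall j, S ord0 j = 0 \/ S ord0 j = 1) /\
    (forall i, F i ord0 = 0 \/ F i ord0 = 1) /\
    (forall i j, U i j = 0 \/ U i j = iC p0 \/ U i j = iC p1) /\
    (forall i j, V i j = 0 \/ V i j = iC q0 \/ V i j = iC q1) /\
    (forall i j, inZ iC (N i j)) /\
    phi = (S *m mxstar (N *m V) *m N *m mxstar (U *m N) *m F) ord0 ord0 /\
    (* N is the least solution of y >= (U y V + N)^* in Mat_n(Z_{C_2'} K) *)
    mxle (mxstar (U *m N *m V + N)) N /\
    (forall Y : 'M[T]_n, (forall i j, inZ iC (Y i j)) ->
       mxle (mxstar (U *m Y *m V + N)) Y -> mxle N Y).
Proof.
move=> _ HC2 Htens phi.
have [_ [e00 [e01 [e10 [e11 _]]]]] := HC2; have [HT [_ [RC _]]] := Htens.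
pose p b := if b then p1 else p0; pose q b := if b then q1 else q0.
have pqE a b : p a * q b = (a == b)%:R by case: a b => [] [].
(* The inner factors [p1], [q1] make a bracket vanish against the delimiters [p0], [q0], since
   [p0 * q1 = p1 * q0 = 0]; between brackets they cancel, leaving [p a * q b]. *)
pose e b := p b * p1; pose f b := q1 * q b.
have ef0 b : p0 * f b = 0 by rewrite /f mulrA e01 mul0r.
have e0f b : e b * q0 = 0 by rewrite /e -mulrA e10 mulr0.
have efE a b : e a * f b = (a == b)%:R.
  by rewrite /e /f mulrA -(mulrA (p a)) e11 mulr1.
have [n [S [F [u [v [X [n_gt0 hS hF hX ->]]]]]]] :=
  Rtensor_recognizable (p := p) (q := q) HC2 Htens phi.
pose U := map_mx (code iC p) u; pose V := map_mx (code iC q) v.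
pose N := dyckmx iC p0 q0 e f u v X.
have N1 : mxle 1%:M N by apply: dyckmx_ge1.
have NN : mxle (N *m N) N by apply: dyckmx_mul.
have UNV : mxle (U *m N *m V) N by apply: dyckmx_nest.
exists n, S, F, U, V, N; split=> //.
split; first by move=> j; apply: hS.
split; first by move=> i; apply: hF.
split; first by move=> i j; rewrite mxE; case: (u i j) => [[]|]; rewrite /= /p; tauto.
split; first by move=> i j; rewrite mxE; case: (v i j) => [[]|]; rewrite /= /q; tauto.
split; first exact: dyckmx_central.
split.
  congr ((_ *m _) _ _); rewrite -!mulmxA; congr (_ *m _); rewrite mulmxA.
  apply: mxstar_normal_form => //; first exact: dyckmx_geX.
  exact: dyckmx_le_star.
split.
  (* [N] is reflexive and transitive and contains [U *m N *m V + N]. *)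
  apply: mxstar_least => //; apply: mxle_trans NN; apply: mxle_mul2r.
  by apply: mxle_join => //; apply: mxle_refl.
(* [N] is a summand under the star, hence below every solution. *)
move=> Y _ hY; apply: (mxle_trans _ hY).
exact: mxle_trans (mxle_addr HT _ _) (mxstar_ge HT _).
Qed.
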